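(* Let $\{X_\ell,f_\ell\}_{\ell=1}^{\infty}$ be an inverse sequence of compact metric spaces and surjective continuous bonding functions $f_\ell:X_{\ell+1}\to X_\ell$, and let $g:\varprojlim\{X_\ell,f_\ell\}_{\ell=1}^{\infty}\to\varprojlim\{X_\ell,f_\ell\}_{\ell=1}^{\infty}$ be a continuous function. The following statements are equivalent. 1. For each $\mathbf x\in\varprojlim\{X_\ell,f_\ell\}_{\ell=1}^{\infty}$, $g(\mathbf x)\neq\mathbf x$. 2. There is $(n,m)\in\mathcal W$ such that $f_{n,m}(x)\notin T_{n,m}(g)(x)$ for each $x\in X_m$. 3. There is a positive integer $N$ such that for each $(n,m)\in\mathcal W$ with $m\ge n\ge N$, $f_{n,m}(x)\notin T_{n,m}(g)(x)$ for each $x\in X_m$.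
   Context: $\mathcal W=\{(n,m)\in\mathbb N\times\mathbb N \mid n\le m\}$, where $\mathbb N$ is the set of positive integers. For an inverse sequence of compact metric spaces $X_\ell$ and continuous maps $f_\ell:X_{\ell+1}\to X_\ell$, the inverse limit $\varprojlim\{X_\ell,f_\ell\}_{\ell=1}^\infty$ is the subspace of $\prod_{\ell=1}^\infty X_\ell$ (product topology) of all $(x_1,x_2,x_3,\ldots)$ with $x_\ell=f_\ell(x_{\ell+1})$ for all $\ell\ge 1$, and $p_n:\varprojlim\{X_\ell,f_\ell\}_{\ell=1}^\infty\to X_n$ is the $n$-th coordinate projection. For $n<m$, $f_{n,m}=f_n\circ f_{n+1}\circ\cdots\circ f_{m-1}:X_m\to X_n$, and $f_{n,n}$ is the identity on $X_n$. For a function $g$ from $\varprojlim\{X_\ell,f_\ell\}_{\ell=1}^\infty$ to itself and positive integers $n,m$, the $T_{n,m}$-transformation of $g$ is the set-valued function on $X_m$ defined by $T_{n,m}(g)(x)=p_n(g(p_m^{-1}(x)))\subseteq X_n$ for $x\in X_m$. *)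

(* Defs.v *)
From HB Require Import structures.
From mathcomp Require Import all_boot all_order all_algebra.
From mathcomp Require Import all_classical all_reals all_analysis.

Set Implicit Arguments.
Unset Strict Implicit.
Unset Printing Implicit Defensive.

Local Open Scope classical_set_scope.

(* Indices start at 0 instead of 1: [X l], [f l] and [invlim_proj l] stand for
   X_(l+1), f_(l+1) and p_(l+1). *)
Section InverseSequence.
Context {R : realType} {X : nat -> metricType R}.
Variable f : forall l, X l.+1 -> X l.
Arguments f : clear implicits.

(* As a subset of [prod_topology X], its type of elements carries the subspace
   topology of the product topology. *)
Definition invlim : set (prod_topology X) :=
  [set x : prod_topology X | forall l, x l = f l (x l.+1)].

Definition invlim_proj (n : nat) (x : invlim) : X n := proj n (\val x).

Fixpoint bond_add (n k : nat) : X (k + n) -> X n :=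
  match k with
  | 0 => id
  | k'.+1 => @bond_add n k' \o f (k' + n)
  end.

(* f_{n,m} = f_n \o ... \o f_{m-1}; the cast identifies X_m with
   X_((m - n) + n). *)
Definition bond (n m : nat) (nm : n <= m) (x : X m) : X n :=
  bond_add (ecast i (X i) (esym (subnK nm)) x).

Lemma bondnn (n : nat) (nn : n <= n) (x : X n) : bond nn x = x.
Proof.
rewrite /bond; move: (esym _); rewrite subnn => e /=.
by rewrite (eq_axiomK e).
Qed.

Lemma bondS (n m : nat) (nm : n <= m) (nm1 : n <= m.+1) (x : X m.+1) :
  bond nm1 x = bond nm (f m x).
Proof.
rewrite /bond; move: (esym (subnK nm1)) (esym (subnK nm)).
rewrite subSn //; move: (m - n) => k e1 e2; subst m.
by rewrite (eq_axiomK e1).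
Qed.

(* The T_{n,m}-transformation T_{n,m}(g) : X_m -> 2^(X_n). *)
Definition Ttrans (g : invlim -> invlim) (n m : nat) (x : X m) : set (X n) :=
  @invlim_proj n @` (g @` (@invlim_proj m @^-1` [set x])).

End InverseSequence.

Arguments invlim_proj {R X f} n x.
Arguments Ttrans {R X f} g n m x.

(* Main.v *)
(**
  [f_{n,m}(x)] lies in [T_{n,m}(g)(x)] exactly when some [y] with [p_m y = x]
  has [p_n (g y) = p_n y].  So, whatever [m] is, statement 2 for [(n, m)] says
  that the coincidence set [C_n] of [p_n \o g] and [p_n] is empty.
  The sets [C_n] are closed and decrease with [n], and their intersection is
  the fixed point set of [g]; compactness of the inverse limit concludes.
*)
Require Import Defs.
From HB Require Import structures.
From mathcomp Require Import all_boot all_order all_algebra.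
From mathcomp Require Import all_classical all_reals all_analysis.

Set Implicit Arguments.
Unset Strict Implicit.
Unset Printing Implicit Defensive.

Local Open Scope classical_set_scope.

(** Near an adherent point [x] there is a coincidence point [y], whose common value [u y] lies in
    any prescribed neighbourhoods of [u x] and [v x]; Hausdorffness concludes. *)
Lemma closed_coincidence {S T : topologicalType} (u v : S -> T) :
  hausdorff_space T -> continuous u -> continuous v ->
  closed [set x | u x = v x].
Proof.
move=> hT cu cv x clx; apply: hT => A B uA vB.
have ABx : nbhs x (u @^-1` A `&` v @^-1` B).
  by apply: filterI; [exact: cu|exact: cv].
have [y [/= uvy [Ay By]]] := clx _ ABx.
by exists (u y); split=> //; rewrite uvy.
Qed.

(** Push the filter forward along [set_val] and take a cluster point in [A]; it lifts back because
    neighbourhoods in the subtype contain traces of open sets of [T]. *)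
Lemma compact_set_type {T : topologicalType} (A : set T) :
  compact A -> compact [set: A].
Proof.
move=> cA F PF _.
have FA : (set_val @ F) A.
  by apply: (@filterE _ F _ (set_val @^-1` A)) => -[z zA]; exact: set_mem.
have [p [Ap clp]] := cA _ (fmap_proper_filter set_val PF) FA.
exists (exist _ p (mem_set Ap)); split=> // U V FU [_ [[W oW <-] /= Wp] WV].
have FU' : (set_val @ F) (set_val @` U).
  by apply: (@filterS _ F _ U) => // z Uz; exists z.
have [_ [[z Uz <-] Wz]] := clp _ _ FU' (open_nbhs_nbhs (conj oW Wp)).
by exists z; split=> //; exact: WV.
Qed.

(** Cantor's intersection theorem: choose [y n] in [C n]. A cluster point of [y] is adherent to each
    [C n], which contains the tail from [n] on. *)
Lemma bigcap_closed_compact_nonempty {T : topologicalType} (C : nat -> set T) :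
  compact [set: T] -> (forall n, closed (C n)) ->
  (forall n m, n <= m -> C m `<=` C n) -> (forall n, C n !=set0) ->
  \bigcap_n C n !=set0.
Proof.
move=> cT clC dC /choice[y Cy].
have [p [_ clp]] := cT (y @ \oo) _ filterT.
exists p => n _; apply: clC => B pB; apply: clp pB.
by exists n => // m /= nm; apply: dC nm _ (Cy m).
Qed.

Section InverseLimit.
Context {R : realType} {X : nat -> metricType R} {f : forall l, X l.+1 -> X l}.
Arguments f : clear implicits.
Implicit Types (x y : invlim f) (g : invlim f -> invlim f).

Lemma invlim_projS n x : invlim_proj n x = f n (invlim_proj n.+1 x).
Proof. by case: x => x /= xP; exact: (set_mem xP). Qed.

Lemma bond_invlim_proj n m (nm : n <= m) x :
  bond f nm (invlim_proj m x) = invlim_proj n x.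
Proof.
elim: m nm => [|m IH] nm.
  have /eqP n0 : n == 0 by rewrite -leqn0.
  by subst n; rewrite bondnn.
have [nm'|mn] := leqP n m; first by rewrite (bondS f nm') -invlim_projS IH.
by have /eqP nE : n == m.+1 by [rewrite eqn_leq nm mn]; subst n; rewrite bondnn.
Qed.

Lemma eq_invlim_proj_le n m x y : n <= m ->
  invlim_proj m x = invlim_proj m y -> invlim_proj n x = invlim_proj n y.
Proof. by move=> nm xy; rewrite -!(bond_invlim_proj nm) xy. Qed.

Lemma eq_invlim x y : (forall n, invlim_proj n x = invlim_proj n y) -> x = y.
Proof. by move=> xy; apply: val_inj; apply: functional_extensionality_dep. Qed.

Lemma Ttrans_bondP g n m (nm : n <= m) (x : X m) :
  Ttrans g n m x (bond f nm x) <->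
  exists y, invlim_proj m y = x /\ invlim_proj n (g y) = invlim_proj n y.
Proof.
split=> [[_ [y /= <- <-] gy]|[y [<- gy]]].
  by exists y; split=> //; rewrite gy bond_invlim_proj.
by exists (g y); [exists y | rewrite bond_invlim_proj].
Qed.

(** The fibres of [invlim_proj m] cover the whole limit, so [m] drops out. *)
Lemma Ttrans_bond_freeP g n m (nm : n <= m) :
  (forall x : X m, ~ Ttrans g n m x (bond f nm x)) <->
  forall y, invlim_proj n (g y) <> invlim_proj n y.
Proof.
split=> [Tg y gy|gP x /Ttrans_bondP[y [_]]]; last exact: gP.
by apply: (Tg (invlim_proj m y)); apply/Ttrans_bondP; exists y.
Qed.

Lemma invlim_proj_continuous n : continuous (invlim_proj n : invlim f -> X n).
Proof.
move=> x; apply: (@continuous_comp (invlim f) (prod_topology X) (X n) set_val).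
  exact: initial_continuous.
exact: proj_continuous.
Qed.

Lemma closed_invlim : (forall l, continuous (f l)) -> closed (invlim f).
Proof.
move=> cf.
(* Each relation cuts out the coincidence set of two continuous maps on the product. *)
have -> : invlim f = \bigcap_l [set x : prod_topology X | x l = f l (x l.+1)].
  by apply/seteqP; split=> [x xP l _|x xP l]; [exact: xP|exact: xP l I].
apply: closed_bigI => l _.
apply: (@closed_coincidence (prod_topology X) _ (proj l) (f l \o proj l.+1)).
- exact: metric_hausdorff.
- exact: proj_continuous.
- by move=> x; apply: continuous_comp; [exact: proj_continuous|exact: cf].
Qed.

Lemma compact_invlim : (forall l, compact [set: X l]) ->
  (forall l, continuous (f l)) -> compact [set: invlim f].
Proof.
move=> cX cf; apply: compact_set_type.
by apply: (subclosed_compact (closed_invlim cf) (tychonoff cX)) => x _ l.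
Qed.

(** The given [y] may depend on [n]; compactness yields one point that serves all coordinates at
    once. *)
Lemma invlim_fixpoint g : (forall l, compact [set: X l]) ->
  (forall l, continuous (f l)) -> continuous g ->
  (forall n, exists y, invlim_proj n (g y) = invlim_proj n y) ->
  exists x, g x = x.
Proof.
move=> cX cf cg fixg.
pose C n := [set y | invlim_proj n (g y) = invlim_proj n y].
have [||n m nm y|x Cx] := @bigcap_closed_compact_nonempty _ C _ _ _ fixg.
- exact: compact_invlim.
- move=> n; apply: closed_coincidence; first exact: metric_hausdorff.
    move=> y; apply: continuous_comp; first exact: cg.
    exact: invlim_proj_continuous.
  exact: invlim_proj_continuous.
- exact: eq_invlim_proj_le.
- by exists x; apply: eq_invlim => n; exact: Cx.
Qed.

End InverseLimit.

Theorem theorem3p6 (R : realType) (X : nat -> metricType R)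
  (f : forall l, X l.+1 -> X l) (g : invlim f -> invlim f) :
  (forall l, compact [set: X l]) ->
  (forall l, continuous (f l)) ->
  (forall l, set_surj [set: X l.+1] [set: X l] (f l)) ->
  continuous g ->
  [<-> forall x : invlim f, g x <> x;
       exists (n m : nat) (nm : n <= m),
         forall x : X m, ~ Ttrans g n m x (bond f nm x);
       exists N : nat, forall (n m : nat) (nm : n <= m), N <= n ->
         forall x : X m, ~ Ttrans g n m x (bond f nm x)].
Proof.
move=> cX cf _ cg; tfae.
- move=> gx; apply: contrapT => Tg.
  (* If statement 2 fails, it fails at every diagonal pair [(n, n)], which gives a coincidence point
     at each level. *)
  suff /(invlim_fixpoint cX cf cg)[x] : forall n,
      exists y, invlim_proj n (g y) = invlim_proj n y by exact: gx.
  move=> n; apply: contrapT => gn; apply: Tg.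
  exists n, n, (leqnn n); apply/Ttrans_bond_freeP => y gy.
  by apply: gn; exists y.
(* The first index of the given pair serves as [N]: a coincidence at a level [n >= N] descends to
   level [N]. *)
- case=> N [m [Nm /Ttrans_bond_freeP gN]]; exists N => n k nk Nn.
  apply/Ttrans_bond_freeP => y gy.
  by apply: (gN y); exact: eq_invlim_proj_le Nn gy.
- case=> N /(_ N N (leqnn N) (leqnn N)) /Ttrans_bond_freeP gN x gx.
  by apply: (gN x); rewrite gx.
Qed.
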